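(* Let $N\ge 1$, let $\Omega\subseteq\mathbb{R}^N$ be a nonempty open set of finite measure and let $2<p\le 2+\frac4N$. If $\bar\lambda\in\mathbb{R}$ is such that there exist two action ground states $v_1,v_2\in\mathcal{N}_{\bar\lambda}$ with different masses (i.e. $\|v_1\|_2\ne\|v_2\|_2$), then $\mathcal{J}$ is not differentiable at $\bar\lambda$.
   Context: $\|\cdot\|_q$ is the norm of $L^q(\Omega)$; functions are real-valued. For $\lambda\in\mathbb{R}$ and $u\in H_0^1(\Omega)$, the action functional is $J_\lambda(u)=\frac12\|\nabla u\|_2^2+\frac\lambda2\|u\|_2^2-\frac1p\|u\|_p^p$. The Nehari manifold is $\mathcal{N}_\lambda=\{u\in H_0^1(\Omega)\setminus\{0\}:\ \|\nabla u\|_2^2+\lambda\|u\|_2^2=\|u\|_p^p\}$. The action ground state level is $\mathcal{J}(\lambda)=\inf_{v\in\mathcal{N}_\lambda}J_\lambda(v)$, a function $\mathcal{J}:\mathbb{R}\to\mathbb{R}$. A function $u\in\mathcal{N}_\lambda$ is an action ground state if $J_\lambda(u)=\mathcal{J}(\lambda)$. The mass of $u$ is $\frac12\|u\|_2^2$. *)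

(* Defs.v *)
From HB Require Import structures.
From mathcomp Require Import all_boot all_order all_algebra.
From mathcomp Require Import all_classical all_reals all_analysis.

Set Implicit Arguments.
Unset Strict Implicit.
Unset Printing Implicit Defensive.
Import Order.TTheory GRing.Theory Num.Theory.
Import numFieldNormedType.Exports.

Local Open Scope classical_set_scope.
Local Open Scope ring_scope.

Fact borel_mx_display : measure_display.
Proof. exact: default_measure_display. Qed.

Section borel_mx.
Context (R : realType) (m n : nat).

Definition borel_mx : set (set 'M[R]_(m, n)) := <<s @open 'M[R]_(m, n) >>.

Let borel_mx0 : borel_mx set0.
Proof. exact: sigma_algebra0. Qed.

Let borel_mxC A : borel_mx A -> borel_mx (~` A).
Proof. exact: sigma_algebraC. Qed.

Let borel_mx_bigcup (F : _^nat) : (forall i, borel_mx (F i)) ->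
  borel_mx (\bigcup_i F i).
Proof. exact: sigma_algebra_bigcup. Qed.

HB.instance Definition _ := @isMeasurable.Build borel_mx_display
  'M[R]_(m, n) borel_mx borel_mx0 borel_mxC borel_mx_bigcup.

End borel_mx.

Section product_cons.
Context d (T : measurableType d) (R : realType) (n : nat).
Context (m1 : {sigma_finite_measure set T -> \bar R}).
Context (m2 : {sigma_finite_measure set (n.-tuple T) -> \bar R}).

Definition tuple_cons (x : T * n.-tuple T) : n.+1.-tuple T :=
  [the n.+1.-tuple T of x.1 :: x.2].

Let measurable_tuple_cons : measurable_fun setT tuple_cons.
Proof. exact: measurable_cons. Qed.

HB.instance Definition _ := isMeasurableFun.Build _ _ _ _ tuple_cons
  measurable_tuple_cons.

Definition product_cons : set (n.+1.-tuple T) -> \bar R :=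
  pushforward (m1 \x m2)%E tuple_cons.

Let product_cons0 : product_cons set0 = 0%E.
Proof. exact: measure0. Qed.

Let product_cons_ge0 A : (0 <= product_cons A)%E.
Proof. exact: measure_ge0. Qed.

Let product_cons_sigma_additive : semi_sigma_additive product_cons.
Proof. exact: measure_semi_sigma_additive. Qed.

HB.instance Definition _ := isMeasure.Build _ _ _ product_cons
  product_cons0 product_cons_ge0 product_cons_sigma_additive.

Let product_cons_sigma_finite : sigma_finite setT product_cons.
Proof.
have /sigma_finiteP[F [TF ndF Foo]] := sigma_finiteT m1.
have /sigma_finiteP[G [TG ndG Goo]] := sigma_finiteT m2.
pose hd (t : n.+1.-tuple T) := tnth t ord0.
pose tl (t : n.+1.-tuple T) : n.-tuple T := [tuple of behead t].
exists (fun k => hd @^-1` F k `&` tl @^-1` G k).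
  apply/esym; rewrite -subTset => t _.
  have [i _ Fi] : (\bigcup_i F i) (hd t) by rewrite -TF.
  have [j _ Gj] : (\bigcup_i G i) (tl t) by rewrite -TG.
  exists (maxn i j) => //; split.
    by have /subsetPset := ndF _ _ (leq_maxl i j); apply.
  by have /subsetPset := ndG _ _ (leq_maxr i j); apply.
move=> k; have [mF Fk] := Foo k; have [mG Gk] := Goo k; split.
  apply: measurableI.
    by rewrite -[X in measurable X]setTI; exact: measurable_tnth.
  by rewrite -[X in measurable X]setTI; exact: measurable_behead.
rewrite /product_cons /pushforward
  (_ : tuple_cons @^-1` _ = F k `*` G k); last first.
  apply/seteqP; split=> -[x t] /=; rewrite /tl /hd (tnth_nth x)/=.
    by move=> [? +]; rewrite (_ : [tuple of _] = t)//; exact: val_inj.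
  by move=> [? ?]; split=> //; rewrite (_ : [tuple of _] = t)//; exact: val_inj.
by rewrite product_measure1E// lte_mul_pinfty// ge0_fin_numE.
Qed.

HB.instance Definition _ := Measure_isSigmaFinite.Build _ _ _ product_cons
  product_cons_sigma_finite.

End product_cons.

Section lebesgue_rV.
Context (R : realType).

Local Notation R' := (measurableTypeR R).

Fixpoint lebesgue_tuple n :
    {sigma_finite_measure set (n.-tuple R') -> \bar R} :=
  match n with
  | 0 => @dirac _ (0.-tuple R') [tuple] R
  | n'.+1 => product_cons (@lebesgue_measure R) (lebesgue_tuple n')
  end.

Section pushforward_row.
Context (n : nat).

Definition rowT (t : n.-tuple R') : 'rV[R]_n := \row_i tnth t i.

Let measurable_rowT : measurable_fun setT rowT.
Proof.
apply: (@measurability _ _ _ _ _ _ (@open 'rV[R]_n)) => // _ [U oU <-].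
rewrite setTI.
pose c (q : 'rV[rat]_n) : 'rV[R]_n := map_mx ratr q.
pose B (a : 'rV[rat]_n * nat) : set 'rV[R]_n := ball (c a.1) a.2.+1%:R^-1.
have UE : U = \bigcup_a (if `[< B a `<=` U >] then B a else set0).
  apply/seteqP; split=> [x Ux|x [a _]]; last first.
    by case: ifPn => // /asboolP; apply.
  have /nbhs_ballP[e /= e0 xeU] : nbhs x U by exact: open_nbhs_nbhs.
  have [k ke] : exists k, k.+1%:R^-1 < e / 2.
    have e20 : 0 < e / 2 by rewrite divr_gt0.
    have [k _ /(_ k (leqnn k))] := near_infty_natSinv_lt (PosNum e20).
    by exists k.
  have /choice[q qP] : forall j : 'I_n, exists q : rat,
      `|x ord0 j - ratr q| < k.+1%:R^-1.
    move=> j; have : x ord0 j - k.+1%:R^-1 < x ord0 j + k.+1%:R^-1.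
      by rewrite ltrBlDr -addrA ltrDl addr_gt0.
    move=> /rat_in_itvoo[q]; rewrite in_itv/= => /andP[q1 q2].
    by exists q; rewrite ltr_distlC q1 q2.
  have qx : ball (c (\row_j q j)) k.+1%:R^-1 x.
    split => // i j; rewrite /ball /= !mxE (ord1 i).
    by rewrite distrC; exact: qP.
  exists (\row_j q j, k) => //; rewrite asboolT//= => y qy; apply: xeU.
  apply: (@ball_splitr _ _ (c (\row_j q j))).
    exact: (le_ball (ltW ke)).
  exact: (le_ball (ltW ke)).
rewrite UE preimage_bigcup; apply: countable_bigcupT_measurable => [|a];
  first exact: countableP.
case: ifPn => _; last by rewrite preimage_set0.
rewrite (_ : _ @^-1` _ = \bigcap_(j in [set: 'I_n])
    (@tnth n R' ^~ j) @^-1` ball (c a.1 ord0 j) a.2.+1%:R^-1); last first.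
  apply/seteqP; split=> [t [_ tB] j _|t tB] /=.
    by have := tB ord0 j; rewrite !mxE.
  by split => // i j; rewrite !mxE (ord1 i); have := tB j I; rewrite /= !mxE.
apply: fin_bigcap_measurable => // j _.
rewrite -[X in measurable X]setTI; apply: measurable_tnth => //.
exact: measurable_realfun.measurable_ball.
Qed.

HB.instance Definition _ := isMeasurableFun.Build _ _ _ _ rowT
  measurable_rowT.

(* the sigma-algebra is Borel, not completed; no difference for L^q classes *)
Definition lebesgue_rV : set 'rV[R]_n -> \bar R :=
  pushforward (lebesgue_tuple n) rowT.

Let lebesgue_rV0 : lebesgue_rV set0 = 0%E.
Proof. exact: measure0. Qed.

Let lebesgue_rV_ge0 A : (0 <= lebesgue_rV A)%E.
Proof. exact: measure_ge0. Qed.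

Let lebesgue_rV_sigma_additive : semi_sigma_additive lebesgue_rV.
Proof. exact: measure_semi_sigma_additive. Qed.

HB.instance Definition _ := isMeasure.Build _ _ _ lebesgue_rV
  lebesgue_rV0 lebesgue_rV_ge0 lebesgue_rV_sigma_additive.

End pushforward_row.

End lebesgue_rV.

Section sobolev.
Context (R : realType) (N : nat).
Implicit Types (Omega : set 'rV[R]_N) (f phi : 'rV[R]_N -> R)
  (g : 'rV[R]_N -> 'rV[R]_N).

Local Notation mu := (@lebesgue_rV R N).

(* the library norm `|v| on 'rV[R]_N is the sup norm *)
Definition euclidean_norm (v : 'rV[R]_N) : R :=
  Num.sqrt (\sum_i v ord0 i ^+ 2).

Definition partial (i : 'I_N) f : 'rV[R]_N -> R :=
  fun x => 'D_(delta_mx ord0 i) f x.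

Definition gradient f : 'rV[R]_N -> 'rV[R]_N := fun x => \row_i partial i f x.

(* all iterated partial derivatives exist and are differentiable (hence
   continuous) everywhere *)
Definition smooth f : Prop :=
  forall (s : seq 'I_N) (x : 'rV[R]_N), differentiable (foldr partial f s) x.

(* C_c^oo(Omega), extended by 0 *)
Definition test_function Omega phi : Prop :=
  smooth phi /\
  exists K : set 'rV[R]_N,
    [/\ compact K, K `<=` Omega & forall x, ~ K x -> phi x = 0].

(* Functions on Omega are represented by functions on R^N, of which only the
   restriction to Omega, up to a.e. equality, is relevant. *)
Definition Lq_norm Omega (q : R) f : \bar R :=
  'N[mu]_(q%:E)[EFin \o (f \_ Omega)].

Definition in_L2 Omega f : Prop := f \_ Omega \in Lfun mu 2%:E.

Definition weak_gradient Omega f g : Prop :=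
  forall phi, test_function Omega phi -> forall i : 'I_N,
    \int[mu]_(x in Omega) (f x * partial i phi x) =
    - \int[mu]_(x in Omega) (g x ord0 i * phi x).

(* An element of H^1(Omega), together with its weak gradient, which is unique
   up to a.e. equality on Omega. *)
Record H1 Omega := mkH1 {
  H1_fun :> 'rV[R]_N -> R;
  H1_grad : 'rV[R]_N -> 'rV[R]_N;
  H1_fun_L2 : in_L2 Omega H1_fun;
  H1_grad_L2 : forall i, in_L2 Omega (fun x => H1_grad x ord0 i);
  H1_weak_gradient : weak_gradient Omega H1_fun H1_grad }.

Local Open Scope ereal_scope.

Definition H1_norm_sq Omega f g : \bar R :=
  Lq_norm Omega 2 f ^+ 2 + Lq_norm Omega 2 (fun x => euclidean_norm (g x)) ^+ 2.

(* H_0^1(Omega): the closure of C_c^oo(Omega) in H^1(Omega) *)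
Definition in_H01 Omega (u : H1 Omega) : Prop :=
  forall e : R, (0 < e)%R -> exists2 phi, test_function Omega phi &
    H1_norm_sq Omega (fun x => u x - phi x)%R
                     (fun x => H1_grad u x - gradient phi x)%R < (e ^+ 2)%:E.

Definition grad_norm Omega (u : H1 Omega) : \bar R :=
  Lq_norm Omega 2 (fun x => euclidean_norm (H1_grad u x)).

Definition mass Omega (u : H1 Omega) : \bar R :=
  2^-1%:E * Lq_norm Omega 2 u ^+ 2.

Definition action Omega (p lambda : R) (u : H1 Omega) : \bar R :=
  2^-1%:E * grad_norm u ^+ 2 + (lambda / 2)%:E * Lq_norm Omega 2 u ^+ 2
  - p^-1%:E * Lq_norm Omega p u `^ p.

(* The equation is in \bar R, so that it includes u \in L^p(Omega). *)
Definition nehari Omega (p lambda : R) : set (H1 Omega) :=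
  [set u | [/\ in_H01 u,
    ~ (u : 'rV[R]_N -> R) = cst 0%R %[ae mu in Omega] &
    grad_norm u ^+ 2 + lambda%:E * Lq_norm Omega 2 u ^+ 2 =
    Lq_norm Omega p u `^ p]].

(* The infimum is a real number: the Nehari manifold is nonempty and the action
   is (1/2 - 1/p) ||u||_p^p >= 0 on it. *)
Definition action_level Omega (p lambda : R) : R :=
  fine (ereal_inf [set action p lambda v | v in @nehari Omega p lambda]).

Definition action_ground_state Omega (p lambda : R) (u : H1 Omega) : Prop :=
  nehari p lambda u /\ action p lambda u = (action_level Omega p lambda)%:E.

End sobolev.

(* Main.v *)
Require Import Defs.
From HB Require Import structures.
From mathcomp Require Import all_boot all_order all_algebra.
From mathcomp Require Import all_classical all_reals all_analysis.
From mathcomp Require Import measurable_realfun ring lra.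
Import Order.TTheory GRing.Theory Num.Theory.
Import numFieldNormedType.Exports.
Local Open Scope classical_set_scope.
Local Open Scope ring_scope.

(** Every action ground state [u] at [lambda] produces a smooth function that
touches the action level [J] from above at [lambda], and whose derivative there
is the mass of [u]. If [J] is differentiable at [lambda], then its derivative
has to be that mass ([derive_action_level]), so that all ground states at
[lambda] have the same mass.

The touching function is the maximal action along the ray through [u]. Write
[G = ||grad u||_2^2], [M = ||u||_2^2], [P = ||u||_p^p] and [A x = G + x M]. Since
[A lambda = P > 0], also [A x > 0] for [x] near [lambda], and then [t u] lies on
the Nehari manifold at [x] for [t = (A x / P)^(1/(p-2))], the solution of
[t^2 A x = t^p P]. Its action is
[g x = (1/2 - 1/p) (A x) (A x / P)^(2/(p-2))], hence [J x <= g x]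
([action_level_le_ray]). At [x = lambda] we get [t = 1], so [g lambda] is the
action of [u] itself, which is [J lambda]. As [1 + 2/(p-2) = p/(p-2)], the
derivative is [g' lambda = (1/2 - 1/p) (p/(p-2)) M = M/2]
([is_derive_ray_action]). The difference [g - J] has a local minimum at
[lambda], hence a vanishing derivative ([derive_at_local_min]).

What remains is that the rays stay in the function spaces: [H_0^1] is closed
under multiplication by [t > 0] ([H1_scale], [in_H01_scale]), and all norms are
homogeneous. *)

(** * Positive homogeneity of integrals and norms *)

Section integral_scaling.
Set Implicit Arguments.
Unset Strict Implicit.
Context d (T : measurableType d) (R : realType).
Variable mu : {measure set T -> \bar R}.
Local Open Scope ereal_scope.

Import HBNNSimple.

(** The integral of a nonnegative function is the supremum of the integrals of
the simple functions below it, and scaling maps the simple functions below [f]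
into those below [k f]. Arguing with simple functions makes the scaling hold for
arbitrary functions, hence for the integrands of the weak gradient identity
without any discussion of their integrability. *)
Lemma ge0_integral_scale_le (D : set T) (f : T -> \bar R) (k : R) :
  (0 < k)%R -> (forall x, 0 <= f x) ->
  k%:E * \int[mu]_(x in D) f x <= \int[mu]_(x in D) (k%:E * f x).
Proof.
move=> k0 f0; rewrite -lee_pdivlMl//.
rewrite ge0_integralE//; apply: ge_ereal_sup => _ [h hf <-].
rewrite lee_pdivlMl// -sintegralrM.
rewrite ge0_integralE; last by move=> x _; rewrite mule_ge0// lee_fin ltW.
apply: ereal_sup_ubound; exists (scale_nnsfun h (ltW k0)) => //= x.
have := hf x; rewrite /patch EFinM; case: ifPn => xD hx.
  by rewrite lee_pmul2l.
by apply: mule_ge0_le0 => //; rewrite lee_fin ltW.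
Qed.

(** The missing inequality is the previous one for [k f] and [k^-1]. *)
Lemma ge0_integral_scale (D : set T) (f : T -> \bar R) (k : R) :
  (0 < k)%R -> (forall x, 0 <= f x) ->
  \int[mu]_(x in D) (k%:E * f x) = k%:E * \int[mu]_(x in D) f x.
Proof.
move=> k0 f0; apply/eqP; rewrite eq_le ge0_integral_scale_le// andbT.
have kV0 : (0 < k^-1)%R by rewrite invr_gt0.
have fK x : k^-1%:E * (k%:E * f x) = f x.
  by rewrite muleA -EFinM mulVf ?gt_eqF// mul1e.
have kf0 x : 0 <= k%:E * f x by rewrite mule_ge0// lee_fin ltW.
have := ge0_integral_scale_le D kV0 kf0.
by under [leRHS]eq_integral do rewrite fK; rewrite lee_pdivrMl.
Qed.

Lemma Rintegral_scale (D : set T) (f : T -> R) (k : R) : (0 < k)%R ->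
  (\int[mu]_(x in D) (k * f x) = k * \int[mu]_(x in D) f x)%R.
Proof.
move=> k0; rewrite /Rintegral.
under eq_integral do rewrite EFinM.
rewrite integralE (integralE _ _ (EFin \o f)).
have kk := ltW k0.
rewrite (ge0_funeposM (EFin \o f) kk) (ge0_funenegM (EFin \o f) kk).
rewrite !ge0_integral_scale//.
have : 0 <= \int[mu]_(x in D) (EFin \o f)^\+ x by exact: integral_ge0.
have : 0 <= \int[mu]_(x in D) (EFin \o f)^\- x by exact: integral_ge0.
move: (\int[mu]_(x in D) (EFin \o f)^\+ x) (\int[mu]_(x in D) (EFin \o f)^\- x).
(* If the positive or the negative part has infinite integral, both sides are
   0, because [fine] maps infinities to 0. *)
by move=> [a| |] [b| |]//= _ _;
  rewrite ?gt0_muley// ?gt0_muleNy ?lte_fin//= ?mulr0// mulrBr.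
Qed.

Lemma Lnorm_scale (q k : R) (f : T -> \bar R) : (0 < q)%R -> (0 < k)%R ->
  'N[mu]_(q%:E)[(fun x => k%:E * f x)] = k%:E * 'N[mu]_(q%:E)[f].
Proof.
move=> q0 k0; rewrite unlock /Lnorm.
under eq_integral do
  rewrite abseM gee0_abs ?lee_fin ?(ltW k0)// poweRM ?lee_fin ?(ltW k0)// poweR_EFin.
rewrite ge0_integral_scale ?powR_gt0//; last by move=> x; exact: poweR_ge0.
rewrite poweRM ?lee_fin ?powR_ge0//; last first.
  by apply: integral_ge0 => x _; exact: poweR_ge0.
by rewrite poweR_EFin -powRrM mulfV ?gt_eqF// powRr1// ltW.
Qed.

End integral_scaling.

(** * Local minima *)

(** The difference quotient at [c] is nonpositive on the left and nonnegative on
the right, so its two one-sided limits, which agree, are 0. The hypothesis speaks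
of [c] alone because the action level is only known to be differentiable at one
point. *)
Lemma derive_at_local_min (R : realFieldType) (f : R -> R) (c : R) :
  derivable f c 1 -> (\forall t \near c, f c <= f t) -> 'D_1 f c = 0.
Proof.
move=> df cmin.
have cm : \forall h \near (0 : R), f c <= f (h + c).
  have : (fun h : R => h + c) @ (0 : R) --> c.
    rewrite -[X in _ --> X]add0r; apply: cvgD => //; exact: cvg_cst.
  by move/(_ _ cmin).
apply/eqP; rewrite eq_le; apply/andP; split.
  rewrite ['D_1 f c]cvg_at_leftE//; apply: limr_le.
    rewrite -(cvg_at_leftE (fun h : R => h^-1 *: ((f \o shift c) _ - f c)))//.
    apply: cvg_trans df; apply: cvg_app.
    move=> A [e egt0 Ae]; exists e => // x xe xgt0; apply: Ae => //.
    exact/ltr0_neq0.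
  near=> h; apply: mulr_le0_ge0.
    by rewrite invr_le0; apply: ltW; near: h; exact: nbhs_left_lt.
  by rewrite subr_ge0 [_%:A]mulr1; near: h; apply: cvg_within.
rewrite ['D_1 f c]cvg_at_rightE//; apply: limr_ge.
  rewrite -(cvg_at_rightE (fun h : R => h^-1 *: ((f \o shift c) _ - f c)))//.
  apply: cvg_trans df; apply: cvg_app.
  move=> A [e egt0 Ae]; exists e => // x xe xgt0; apply: Ae => //.
  exact/lt0r_neq0.
near=> h; apply: mulr_ge0.
  by rewrite invr_ge0; apply: ltW; near: h; exact: nbhs_right_gt.
by rewrite subr_ge0 [_%:A]mulr1; near: h; apply: cvg_within.
Unshelve. all: by end_near. Qed.

(** * Scaling in the Sobolev spaces *)

Section sobolev_scaling.
Set Implicit Arguments.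
Unset Strict Implicit.
Context (R : realType) (N : nat) (Omega : set 'rV[R]_N).
Implicit Types (f phi : 'rV[R]_N -> R) (g : 'rV[R]_N -> 'rV[R]_N) (u : H1 Omega).

Lemma restrict_scale (k : R) f :
  (fun x => k * f x) \_ Omega = (fun x => k * (f \_ Omega) x).
Proof.
by apply/funext => x; rewrite /patch; case: ifPn => // _; rewrite mulr0.
Qed.

Lemma euclidean_norm_scale (k : R) (v : 'rV[R]_N) : 0 <= k ->
  euclidean_norm (k *: v) = k * euclidean_norm v.
Proof.
move=> k0; rewrite /euclidean_norm.
under eq_bigr do rewrite mxE exprMn.
by rewrite -mulr_sumr sqrtrM ?sqr_ge0// sqrtr_sqr ger0_norm.
Qed.

Lemma Lq_norm_scale (q k : R) f : 0 < q -> 0 < k ->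
  Lq_norm Omega q (fun x => k * f x) = (k%:E * Lq_norm Omega q f)%E.
Proof. by move=> q0 k0; rewrite /Lq_norm restrict_scale -Lnorm_scale. Qed.

Lemma in_L2_scale (k : R) f : in_L2 Omega f -> in_L2 Omega (fun x => k * f x).
Proof.
rewrite /in_L2 restrict_scale => fL2.
have -> : (fun x => k * (f \_ Omega) x) = k \o* (f \_ Omega).
  by apply/funext => x /=; rewrite mulrC.
by apply: Lfun_scale => //; rewrite ler1n.
Qed.

Lemma iter_partial_scale (k : R) phi (s : seq 'I_N) : smooth phi ->
  foldr (@partial R N) (k \*: phi) s = k \*: foldr (@partial R N) phi s.
Proof.
move=> sphi; elim: s => //= i s ->; apply/funext => x.
by rewrite /partial deriveZ//; apply: diff_derivable; exact: sphi.
Qed.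

Lemma test_function_scale (k : R) phi :
  test_function Omega phi -> test_function Omega (k \*: phi).
Proof.
move=> [sphi [K [cK KO phi0]]]; split.
  by move=> s x; rewrite iter_partial_scale//; exact/differentiableZ/sphi.
by exists K; split=> // x Kx; rewrite /= phi0// scaler0.
Qed.

Lemma gradient_scale (k : R) phi (x : 'rV[R]_N) : smooth phi ->
  gradient (k \*: phi) x = k *: gradient phi x.
Proof.
move=> sphi; apply/rowP => i; rewrite !mxE.
by have /(congr1 (fun h => h x)) := @iter_partial_scale k phi [:: i] sphi.
Qed.

Lemma weak_gradient_scale (k : R) f g : 0 < k -> weak_gradient Omega f g ->
  weak_gradient Omega (fun x => k * f x) (fun x => k *: g x).
Proof.
move=> k0 fg phi tphi i.
have E (h1 h2 : 'rV[R]_N -> R) :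
    \int[@lebesgue_rV R N]_(x in Omega) (k * h1 x * h2 x) =
    k * \int[@lebesgue_rV R N]_(x in Omega) (h1 x * h2 x).
  by under eq_Rintegral do rewrite -mulrA; rewrite Rintegral_scale.
under [in RHS]eq_Rintegral do rewrite mxE.
by rewrite !E fg// mulrN.
Qed.

Definition H1_scale (k : R) (k0 : 0 < k) u : H1 Omega.
Proof.
apply: (@mkH1 R N Omega (fun x => k * u x) (fun x => k *: H1_grad u x)).
- exact/in_L2_scale/H1_fun_L2.
- move=> i; rewrite (_ : (fun _ => _) = (fun x => k * H1_grad u x ord0 i)).
    exact/in_L2_scale/H1_grad_L2.
  by apply/funext => x; rewrite mxE.
- exact/weak_gradient_scale/H1_weak_gradient.
Defined.

Lemma Lq_norm_grad_scale (k : R) g : 0 < k ->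
  Lq_norm Omega 2 (fun x => euclidean_norm (k *: g x)) =
  (k%:E * Lq_norm Omega 2 (fun x => euclidean_norm (g x)))%E.
Proof.
move=> k0; rewrite -Lq_norm_scale//; congr Lq_norm.
by apply/funext => x; rewrite euclidean_norm_scale// ltW.
Qed.

Lemma sqre_scale (k : R) (x : \bar R) :
  ((k%:E * x) ^+ 2 = (k ^+ 2)%:E * x ^+ 2)%E.
Proof. by rewrite !expe2 EFin_expe expe2 muleACA. Qed.

Lemma H1_norm_sq_scale (k : R) f g : 0 < k ->
  H1_norm_sq Omega (fun x => k * f x) (fun x => k *: g x) =
  ((k ^+ 2)%:E * H1_norm_sq Omega f g)%E.
Proof.
move=> k0; rewrite /H1_norm_sq Lq_norm_scale// Lq_norm_grad_scale// !sqre_scale.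
by rewrite ge0_muleDr// expe_ge0 ?Lnorm_ge0.
Qed.

(** The scaled function is approximated within [e] by [k phi], where [phi]
approximates [u] within [e / k]. *)
Lemma in_H01_scale (k : R) (k0 : 0 < k) u : in_H01 u -> in_H01 (H1_scale k0 u).
Proof.
move=> u0 e e0; have [phi tphi ephi] := u0 (e / k) (divr_gt0 e0 k0).
exists (k \*: phi); first exact: test_function_scale.
have -> : (fun x => H1_scale k0 u x - (k \*: phi) x) =
          (fun x => k * (u x - phi x)).
  by apply/funext => x; rewrite mulrBr.
have -> : (fun x => H1_grad (H1_scale k0 u) x - gradient (k \*: phi) x) =
          (fun x => k *: (H1_grad u x - gradient phi x)).
  by apply/funext => x; rewrite gradient_scale ?scalerBr//; case: tphi.
rewrite H1_norm_sq_scale// -lte_pdivlMl ?exprn_gt0//.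
by rewrite -EFinM mulrC -exprVn -exprMn.
Qed.

Lemma grad_norm_scale (k : R) (k0 : 0 < k) u :
  grad_norm (H1_scale k0 u) = (k%:E * grad_norm u)%E.
Proof. exact: Lq_norm_grad_scale. Qed.

Lemma ae_neq0_scale (k : R) (k0 : 0 < k) u :
  ~ (u : 'rV[R]_N -> R) = cst 0 %[ae @lebesgue_rV R N in Omega] ->
  ~ (H1_scale k0 u : 'rV[R]_N -> R) = cst 0 %[ae @lebesgue_rV R N in Omega].
Proof.
apply: contra_not; apply: filterS => x /= ku0 Ox.
by apply/eqP; have /eqP := ku0 Ox; rewrite mulf_eq0 gt_eqF.
Qed.

Lemma Lq_norm_gt0 (q : R) u : 0 < q ->
  ~ (u : 'rV[R]_N -> R) = cst 0 %[ae @lebesgue_rV R N in Omega] ->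
  (0 < Lq_norm Omega q u)%E.
Proof.
move=> q0 u0; rewrite lt_neqAle Lnorm_ge0 andbT; apply/eqP => /esym nu0.
apply: u0.
have mu_ : measurable_fun setT (u \_ Omega).
  by have := H1_fun_L2 u; rewrite /in_L2 inE => /andP[] /[!inE].
have q0' : (0 < q%:E)%E by rewrite lte_fin.
have mu_E : measurable_fun setT (EFin \o (u \_ Omega)) by exact/measurable_EFinP.
have := @Lnorm_eq0_eq0 _ _ _ (@lebesgue_rV R N) _ _ mu_E q0' nu0.
apply: filterS => x /= /(_ I) + Ox.
by rewrite /patch mem_set// => -[].
Qed.

End sobolev_scaling.

(** * The action along the ray through a ground state *)

Section ground_states.
Set Implicit Arguments.
Unset Strict Implicit.
Context (R : realType) (N : nat) (Omega : set 'rV[R]_N).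
Implicit Types (u v : H1 Omega) (p lambda : R).

Lemma Lq_norm2_fin_num u : (Lq_norm Omega 2 u \is a fin_num)%E.
Proof.
rewrite ge0_fin_numE ?Lnorm_ge0//.
by have := H1_fun_L2 u; rewrite /in_L2 inE => /andP[_] /[!inE].
Qed.

(** The squared gradient norm and the [p]-th power of the [L^p] norm are equal up
to a real number on the Nehari manifold. If one of them were infinite, then both
would be, and the action would contain [+oo - oo = -oo]; but the action of a
ground state is a real number. *)
Lemma ground_state_norms p lambda u : 2 < p ->
  action_ground_state p lambda u ->
  exists G M P : R, [/\ (grad_norm u ^+ 2 = G%:E)%E,
    (Lq_norm Omega 2 u ^+ 2 = M%:E)%E, (Lq_norm Omega p u `^ p = P%:E)%E,
    0 < P & G + lambda * M = P /\ action_level Omega p lambda = (2^-1 - p^-1) * P].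
Proof.
move=> p2 [[u0 une eqn] act].
have p0 : 0 < p by lra.
move: eqn act; rewrite /action.
have /fineK <- : (Lq_norm Omega 2 u ^+ 2)%E \is a fin_num.
  by rewrite fin_numX// Lq_norm2_fin_num.
move: (fine (Lq_norm Omega 2 u ^+ 2)) => M.
have : (0 < Lq_norm Omega p u `^ p)%E by rewrite poweR_gt0// Lq_norm_gt0.
have : (0 <= grad_norm u ^+ 2)%E by rewrite expe_ge0// Lnorm_ge0.
move: (grad_norm u ^+ 2)%E (Lq_norm Omega p u `^ p)%E => [G| |] [P| |]//= G0 P0.
  move=> [eqn] [act]; exists G, M, P; split => //.
  by split=> //; rewrite -act -eqn; field; rewrite gt_eqF.
move=> _; rewrite gt0_muley ?lte_fin ?invr_gt0// gt0_muley ?lte_fin ?invr_gt0//.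
Qed.

(** The bound [0 <= r] covers the case in which the infimum is [-oo], where [fine]
makes the level 0. *)
Lemma action_level_le p lambda r u : nehari p lambda u ->
  action p lambda u = r%:E -> 0 <= r -> action_level Omega p lambda <= r.
Proof.
move=> nu ur r0; rewrite /action_level.
have : (ereal_inf [set action p lambda v | v in @nehari R N Omega p lambda] <= r%:E)%E.
  by apply: ereal_inf_lbound; exists u.
by case: ereal_inf.
Qed.

(** The bound is the action of the unique positive multiple of [u] on the Nehari
manifold. *)
Lemma action_level_le_ray p lambda u (G M P : R) : 2 < p -> in_H01 u ->
  ~ (u : 'rV[R]_N -> R) = cst 0 %[ae @lebesgue_rV R N in Omega] ->
  (grad_norm u ^+ 2 = G%:E)%E -> (Lq_norm Omega 2 u ^+ 2 = M%:E)%E ->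
  (Lq_norm Omega p u `^ p = P%:E)%E -> 0 < P -> 0 < G + lambda * M ->
  action_level Omega p lambda <=
  (2^-1 - p^-1) * ((G + lambda * M) * ((G + lambda * M) / P) `^ (2 / (p - 2))).
Proof.
move=> p2 u0 une uG uM uP P0 A0.
have p0 : 0 < p by lra.
have p20 : p - 2 != 0 by rewrite gt_eqF// subr_gt0.
set A := G + lambda * M in A0 *.
have AP0 : 0 < A / P by rewrite divr_gt0.
(* the solution of [t^2 A = t^p P] *)
pose t := (A / P) `^ (p - 2)^-1.
have t0 : 0 < t by rewrite powR_gt0.
have t2 : t ^+ 2 = (A / P) `^ (2 / (p - 2)).
  rewrite -powR_mulrn; last exact: ltW.
  by rewrite -powRrM [_^-1 * _]mulrC.
have tp : t `^ p * P = t ^+ 2 * A.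
  have -> : t `^ p = t ^+ 2 * (t `^ (p - 2)).
    rewrite -powR_mulrn ?ltW// -powRD; last by rewrite (gt_eqF t0) implybT.
    by congr (_ `^ _); rewrite addrC subrK.
  have -> : t `^ (p - 2) = A / P.
    by rewrite /t -powRrM mulVf// powRr1 ?ltW.
  by rewrite -mulrA divfK// gt_eqF.
have gradt : (grad_norm (H1_scale t0 u) ^+ 2 = (t ^+ 2 * G)%:E)%E.
  by rewrite grad_norm_scale sqre_scale uG.
have L2t : (Lq_norm Omega 2 (H1_scale t0 u) ^+ 2 = (t ^+ 2 * M)%:E)%E.
  by rewrite Lq_norm_scale// sqre_scale uM.
have Lpt : (Lq_norm Omega p (H1_scale t0 u) `^ p = (t `^ p * P)%:E)%E.
  by rewrite Lq_norm_scale// poweRM ?lee_fin ?ltW ?Lq_norm_gt0// uP poweR_EFin.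
apply: (@action_level_le _ _ _ (H1_scale t0 u)).
- split; [exact: in_H01_scale|exact: ae_neq0_scale|].
  by rewrite gradt L2t Lpt tp -EFinM -EFinD; congr (_%:E); rewrite /A; ring.
- rewrite /action gradt L2t Lpt tp -!EFinM -EFinB; congr (_%:E).
  by rewrite -t2 /A; field; rewrite gt_eqF.
- rewrite mulr_ge0//; last by rewrite mulr_ge0 ?powR_ge0// ltW.
  by rewrite subr_ge0 lef_pV2 ?posrE// ltW.
Qed.

(** With the affine function [h x = (G + x M) / P], for which [h lambda = 1], the
action is a constant multiple of [h * h^(2/(p-2))]. *)
Lemma is_derive_ray_action (p G M P lambda : R) : 2 < p -> 0 < P ->
  G + lambda * M = P ->
  is_derive lambda 1 (fun x : R =>
    (2^-1 - p^-1) * ((G + x * M) * ((G + x * M) / P) `^ (2 / (p - 2))))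
    (2^-1 * M).
Proof.
move=> p2 P0 AP.
have P0' : P != 0 by rewrite gt_eqF.
have p20 : p - 2 != 0 by rewrite gt_eqF// subr_gt0.
have p0 : p != 0 by rewrite gt_eqF//; lra.
pose h : R -> R := cst (G / P) + (M / P) \*: id.
have hE x : (G + x * M) / P = h x.
  by rewrite /h !fctE /= /GRing.scale/=; field.
have h1 : h lambda = 1 by rewrite -hE AP divff.
have dh : is_derive lambda 1 h (M / P).
  by apply: is_derive_eq; rewrite add0r [_ *: _]mulr1.
have dk : is_derive lambda 1 ((@powR R)^~ (2 / (p - 2)) \o h) (2 / (p - 2) * (M / P)).
  have hl0 : 0 < h lambda by rewrite h1.
  have dpow : is_derive (h lambda) 1 ((@powR R)^~ (2 / (p - 2))) (2 / (p - 2)).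
    have := is_derive1_powR (2 / (p - 2)) hl0.
    by move=> /is_derive_eq; apply; rewrite h1 powR1 mulr1.
  by apply: is_derive_eq; rewrite mulrC.
have -> : (fun x : R =>
    (2^-1 - p^-1) * ((G + x * M) * ((G + x * M) / P) `^ (2 / (p - 2)))) =
    ((2^-1 - p^-1) * P) \*: (h * ((@powR R)^~ (2 / (p - 2)) \o h)).
  apply/funext => x; rewrite hE !fctE /= /GRing.scale/= -mulrA; congr (_ * _).
  by rewrite mulrA; congr (_ * _); rewrite -hE; field.
apply: is_derive_eq; rewrite /= h1 powR1 /GRing.scale/=; field.
by rewrite P0' p0 p20.
Qed.

(** The action along the ray through [u] dominates the level near [lambda] and
agrees with it at [lambda], so the two derivatives coincide. *)
Lemma derive_action_level p lambda u : 2 < p -> action_ground_state p lambda u ->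
  differentiable (action_level Omega p) lambda ->
  mass u = ('D_1 (action_level Omega p) lambda)%:E.
Proof.
move=> p2 gu /derivable1_diffP dJ.
have [[u0 une _] _] := gu.
have [G [M [P [uG uM uP P0 [AP JP]]]]] := ground_state_norms p2 gu.
pose g x := (2^-1 - p^-1) * ((G + x * M) * ((G + x * M) / P) `^ (2 / (p - 2))).
have dg : is_derive lambda 1 g (2^-1 * M) by exact: is_derive_ray_action.
have gJ : g lambda = action_level Omega p lambda.
  by rewrite /g AP divff ?gt_eqF// powR1 mulr1.
have : 'D_1 (g - action_level Omega p) lambda = 0.
  apply: derive_at_local_min; first exact: derivableB.
  have : \forall x \near lambda, 0 < G + x * M.
    have : (fun x : R => G + x * M) x @[x --> lambda] --> P.
      by rewrite -AP; apply: cvgD; [exact: cvg_cst|apply: cvgMl; exact: cvg_id].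
    by move/cvgr_gt; apply.
  apply: filterS => x A0; rewrite !fctE gJ subrr subr_ge0.
  exact: (action_level_le_ray p2 u0).
rewrite deriveB// derive_val => /eqP; rewrite subr_eq0 => /eqP <-.
by rewrite /mass uM -EFinM.
Qed.
End ground_states.

Theorem corollary1p6 (R : realType) (N : nat) (Omega : set 'rV[R]_N)
    (p lambda : R) :
  (1 <= N)%N ->
  open Omega -> Omega !=set0 -> (lebesgue_rV Omega < +oo)%E ->
  2 < p -> p <= 2 + 4 / N%:R ->
  (exists v1 v2 : H1 Omega,
    [/\ action_ground_state p lambda v1,
        action_ground_state p lambda v2 & mass v1 <> mass v2]) ->
  ~ differentiable (action_level Omega p) lambda.
Proof.
move=> _ _ _ _ p2 _ [v1 [v2 [gv1 gv2 m12]]] dJ; apply: m12.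
by rewrite (derive_action_level p2 gv1)// (derive_action_level p2 gv2).
Qed.
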